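(* Let $\mu_n$ and $\sigma_n^2$ (with $\sigma_n\ge0$) be the expected value and the variance of the random variable $X_n$. There is a constant $C>0$ such that for all integers $n\ge2$ and all $x\in\mathbb{R}$, $$\left|P\left(\frac{X_n-\mu_n}{\sigma_n}\le x\right)-\Phi(x)\right|\le C\,\sigma_n^{-1},$$ and $C$ can be chosen as $C=0.7975$.
   Context: The polynomials $Q_n(x)$ are defined by $Q_0(x)=1$ and $Q_n(x)=x\sum_{k=1}^n k\,Q_{n-k}(x)$ for $n\ge 1$. The numbers $A_{n,k}$ are their coefficients: $Q_n(x)=\sum_{k=0}^n A_{n,k}x^k$. For $n\ge1$ and $0\le k\le n$ one has $A_{n,k}=\binom{n+k-1}{2k-1}$, with $A_{n,0}=0$. For $n\ge1$, $X_n$ is a random variable with values in $\{0,1,\dots,n\}$ and $P(X_n=k)=A_{n,k}/\sum_{m=0}^n A_{n,m}$. The function $\Phi(x)=\frac{1}{\sqrt{2\pi}}\int_{-\infty}^x e^{-t^2/2}\,dt$ is the standard normal distribution function. *)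

(* Defs.v *)
From HB Require Import structures.
From mathcomp Require Import all_boot all_order all_algebra.
From mathcomp Require Import all_classical all_reals all_analysis.

Set Implicit Arguments.
Unset Strict Implicit.
Unset Printing Implicit Defensive.

Import Order.TTheory GRing.Theory Num.Theory.
Import numFieldNormedType.Exports.

Local Open Scope classical_set_scope.
Local Open Scope ring_scope.

(* [Qseq n] is the list [:: Q_0; ...; Q_n]; carrying the whole history makes
   the course-of-values recursion for Q structural. See Q0 and Q_rec. *)
Fixpoint Qseq (R : realType) (n : nat) : seq {poly R} :=
  if n is m.+1 then
    let s := Qseq R m in
    rcons s ('X * \sum_(1 <= k < m.+2) k%:R *: nth 0 s (m.+1 - k))
  else [:: 1].

Definition Q (R : realType) (n : nat) : {poly R} := nth 0 (Qseq R n) n.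

Lemma size_Qseq (R : realType) n : size (Qseq R n) = n.+1.
Proof. by elim: n => //= n IHn; rewrite size_rcons IHn. Qed.

Lemma nth_Qseq (R : realType) n i : (i <= n)%N -> nth 0 (Qseq R n) i = Q R i.
Proof.
elim: n => [|n IHn]; first by rewrite leqn0 => /eqP ->.
rewrite leq_eqVlt => /predU1P[-> //|lt_in].
by rewrite /= nth_rcons size_Qseq lt_in IHn.
Qed.

Lemma Q0 (R : realType) : Q R 0 = 1.
Proof. by []. Qed.

Lemma Q_rec (R : realType) n : (0 < n)%N ->
  Q R n = 'X * \sum_(1 <= k < n.+1) k%:R *: Q R (n - k).
Proof.
case: n => // n _; rewrite {1}/Q /= nth_rcons size_Qseq ltnn eqxx.
congr (_ * _); apply: eq_big_nat => -[//|k] _.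
by rewrite nth_Qseq // subSS leq_subr.
Qed.

Definition A (R : realType) (n k : nat) : R := (Q R n)`_k.

Definition has_law_A (R : realType) (d : measure_display)
    (T : measurableType d) (P : probability T R) (n : nat)
    (X : {RV P >-> R}) : Prop :=
  (forall t, exists2 k : nat, (k <= n)%N & X t = k%:R) /\
  (forall k : nat, (k <= n)%N ->
     P [set t | X t = k%:R] = (A R n k / \sum_(0 <= m < n.+1) A R n m)%:E).

Definition mean (R : realType) (d : measure_display) (T : measurableType d)
  (P : probability T R) (X : {RV P >-> R}) : R := fine 'E_P[X].

Definition stddev (R : realType) (d : measure_display) (T : measurableType d)
  (P : probability T R) (X : {RV P >-> R}) : R := Num.sqrt (fine 'V_P[X]).

Definition Phi (R : realType) (x : R) : R :=
  (Num.sqrt (2 * pi))^-1 *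
  \int[lebesgue_measure]_(t in `]-oo, x]) expR (- (t ^+ 2) / 2).

(* X_n is only specified through its law, so the bound is required of every
   random variable with that law, on every probability space. *)
Definition normal_approximation (R : realType) (C : R) : Prop :=
  forall n : nat, (2 <= n)%N ->
  forall (d : measure_display) (T : measurableType d) (P : probability T R)
    (X : {RV P >-> R}), has_law_A n X ->
  forall x : R,
    `| fine (P [set t | (X t - mean X) / stddev X <= x]) - Phi x |
      <= C * (stddev X)^-1.

(* Main.v *)
From HB Require Import structures.
Require Import Defs.
From mathcomp Require Import all_boot all_order all_algebra.
From mathcomp Require Import all_classical all_reals all_analysis.
From mathcomp Require Import measurable_realfun ring lra.

(** The polynomial [Q n] is ['X] times a Chebyshev polynomial of the second kind
    in an affine function of the variable, so that its roots are the nonpositive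
    real numbers [2 * cos (j * pi / n) - 2] with [0 <= j < n] ([Q_factor]).
    Divided by its value at [1], each linear factor is the generating function
    of a Bernoulli variable; the random variable [X_n] is therefore distributed
    as a sum [S] of independent Bernoulli variables [b_i], of parameters [p_i],
    and its variance [sigma ^+ 2] is the sum of the [p_i * (1 - p_i)]
    ([A_pb_law]).

    For such a sum the distance to the normal distribution function turns out to
    be at most the largest point probability [B] of the sums [S_i] that omit one
    term. Let [f] be the bounded solution of Stein's equation
    [f' w = w * f w + (w <= x)%:R - Phi x] at an atom [x] of the standardised
    sum. The Mills ratio inequalities say that [g w = w * f w] is nondecreasing
    with total variation at most [1]. The zero-bias identity [Stein_identity]
    writes [E (g S)] as an average over [i], with weights proportional to
    [p_i * (1 - p_i)], of increments of [f] between neighbouring lattice points,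
    and by the mean value theorem each of these increments lies between two
    explicit expressions in [g] and [Phi x]. In the term of index [i] the
    increments of [g] contribute [p_i * B] because [g] has total variation
    at most [1], and the shift from [S_i] to [S] contributes
    [(1 - p_i) * B]; hence the bound [B] ([cdf_sub_Phi_le], [Phi_sub_cdf_le]).

    The point probabilities are bounded by Fourier inversion. The modulus of the
    characteristic function of a sum of variance [V] is at most
    [(1 + V * (1 - cos t))^-1], a multiple of a Poisson kernel whose mean over
    the circle is [(sqrt (1 + 2 * V))^-1] ([coef_prod_bernoulli_le]). Omitting a
    term lowers the variance by at most [1 / 4], so [B] is at most
    [(sqrt 2 * sigma)^-1] ([law_but_le]), and [1 / sqrt 2] is less than [0.7975]. *)

Set Implicit Arguments.
Unset Strict Implicit.
Unset Printing Implicit Defensive.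

Import Order.TTheory GRing.Theory Num.Theory.
Import numFieldNormedType.Exports.
Local Open Scope classical_set_scope.
Local Open Scope ring_scope.

(** * The standard normal distribution function *)

Section Gaussian.
Variable R : realType.
Implicit Types (x t : R).

Definition gauss x : R := (Num.sqrt (2 * pi))^-1 * expR (- (x ^+ 2) / 2).

Lemma gauss_pdf x : gauss x = normal_pdf 0 1 x.
Proof.
rewrite normal_pdfE ?oner_neq0// /normal_peak /normal_fun expr1n subr0 mul1r.
by rewrite /gauss mulr_natl.
Qed.

Lemma gauss_gt0 x : 0 < gauss x.
Proof. by rewrite mulr_gt0 ?expR_gt0// invr_gt0 sqrtr_gt0 mulr_gt0// pi_gt0. Qed.

Lemma PhiE x : Phi x = \int[lebesgue_measure]_(t in `]-oo, x]) normal_pdf 0 1 t.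
Proof.
rewrite /Phi -RintegralZl//; last first.
  have -> : (EFin \o fun t => expR (- t ^+ 2 / 2)) =
            (fun t => ((Num.sqrt (2 * pi))%:E * (normal_pdf 0 1 t)%:E)%E).
    apply/funext => t /=; rewrite -gauss_pdf -EFinM /gauss mulVKf//.
    by rewrite gt_eqF// sqrtr_gt0 mulr_gt0// pi_gt0.
  apply: integrableZl => //.
  by apply: integrableS (integrable_normal_pdf 0 1).
apply: eq_Rintegral => t _; exact: gauss_pdf.
Qed.

Lemma is_derive_Phi x : is_derive x 1 (@Phi R) (gauss x).
Proof.
have [] := @continuous_FTC1 R (normal_pdf 0 1) -oo%O x (x + 1) _ _ _ _.
- by rewrite ltrDl.
- by apply: integrableS (integrable_normal_pdf 0 1).
- exact: ltNyr.
- exact/continuous_normal_pdf/oner_neq0.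
move=> d1 d2; have -> : @Phi R = fun x => \int[lebesgue_measure]_(t in `]-oo, x]) normal_pdf 0 1 t.
  by apply/funext => y; exact: PhiE.
apply: DeriveDef => //; by rewrite -derive1E d2 gauss_pdf.
Qed.

Let idR : measurableTypeR R -> R := idfun.
#[local] HB.instance Definition _ :=
  @isMeasurableFun.Build _ _ _ _ idR (@measurable_id _ _ setT).

Lemma Phi_cdf x : (Phi x)%:E = cdf (idR : {RV (normal_prob (0 : R) 1) >-> R}) x.
Proof.
rewrite PhiE /Rintegral fineK//.
apply: integrable_fin_num => //.
by apply: integrableS (integrable_normal_pdf 0 1).
Qed.

Lemma Phi_ge0 x : 0 <= Phi x.
Proof. by rewrite -lee_fin Phi_cdf. Qed.

Lemma Phi_le1 x : Phi x <= 1.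
Proof. by rewrite -lee_fin Phi_cdf cdf_le1. Qed.

Lemma Phi_nondecreasing : {homo @Phi R : x y / x <= y}.
Proof. by move=> x y xy; rewrite -lee_fin !Phi_cdf cdf_nondecreasing. Qed.

Lemma Phi_cvgy : @Phi R x @[x --> +oo] --> (1 : R).
Proof.
have := @cvg_cdfy1 _ _ _ _ (idR : {RV (normal_prob (0 : R) 1) >-> R}).
rewrite (_ : cdf _ = fun x => (Phi x)%:E) ; last by apply/funext => x; rewrite Phi_cdf.
by move/fine_cvgP => [].
Qed.

Lemma Phi_cvgNy : @Phi R x @[x --> -oo] --> (0 : R).
Proof.
have := @cvg_cdfNy0 _ _ _ _ (idR : {RV (normal_prob (0 : R) 1) >-> R}).
rewrite (_ : cdf _ = fun x => (Phi x)%:E) ; last by apply/funext => x; rewrite Phi_cdf.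
by move/fine_cvgP => [].
Qed.
End Gaussian.

(** * Mills' ratio and the solution of Stein's equation *)

Section Mills.
Variable R : realType.
Implicit Types (x t a : R).

Lemma is_derive_mean_value (f df : R -> R) a b : a <= b ->
  (forall t, a <= t <= b -> is_derive t 1 f (df t)) ->
  exists2 c, a <= c <= b & f b - f a = df c * (b - a).
Proof.
rewrite le_eqVlt => /predU1P[<- _|ab dfE].
  by exists a; rewrite ?lexx// !subrr mulr0.
have [||c] := @MVT R f df a b ab.
- by move=> t; rewrite in_itv/= => /andP[at_ tb]; apply: dfE; rewrite !ltW.
- apply: derivable_within_continuous => t; rewrite in_itv/= => tab.
  by have [] := dfE t tab.
- by rewrite in_itv/= => /andP[ac cb] fE; exists c; rewrite ?fE// !ltW.
Qed.

(** The comparisons with the normal tail below concern functions that vanish at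
    infinity and have a derivative of constant sign. The limit enters through a majorant [b], so that [f] itself need not be shown to
    converge. *)
Lemma nonpos_of_derive_ge0 (f df b : R -> R) a :
  (forall t, a <= t -> is_derive t 1 f (df t)) ->
  (forall t, a <= t -> 0 <= df t) ->
  (forall t, a <= t -> f t <= b t) -> b t @[t --> +oo] --> (0 : R) ->
  f a <= 0.
Proof.
move=> dfE df0 fb b0; apply: (cvgr_to_ge b0).
near=> t; have at_ : a <= t by near: t; apply: nbhs_pinfty_ge; exact: num_real.
apply: le_trans (fb _ at_); rewrite -subr_ge0.
have [|c /andP[ac _] ->] := @is_derive_mean_value f df a t at_.
  by move=> s /andP[as_ _]; exact: dfE.
by rewrite mulr_ge0 ?subr_ge0// df0.
Unshelve. all: by end_near. Qed.

Lemma is_derive_gauss x : is_derive x 1 (@gauss R) (- x * gauss x).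
Proof.
rewrite /gauss; apply: is_derive_eq.
rewrite /GRing.scale/= !(mulr1,mulr0,expr1,add0r).
have -> : 2^-1 * - (x + x) = - x :> R by field.
ring.
Qed.

Lemma gauss_le_expN x : gauss x <= gauss 0 * expR (2^-1) * expR (- x).
Proof.
rewrite /gauss expr0n/= oppr0 mul0r expR0 mulr1 -mulrA -expRD ler_pM2l.
  by rewrite ler_expR; have := sqr_ge0 (x - 1); rewrite expr2; nra.
by rewrite invr_gt0 sqrtr_gt0 mulr_gt0// pi_gt0.
Qed.

(** For [x > 0], the difference of the two sides divided by [x] increases with
    derivative [gauss t / t ^+ 2], and it vanishes at infinity. *)
Lemma Mills_upper x : x * (1 - Phi x) <= gauss x.
Proof.
have [x0|x0] := leP x 0.
  by rewrite (le_trans (mulr_le0_ge0 x0 _)) ?subr_ge0 ?Phi_le1// ltW// gauss_gt0.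
rewrite mulrC -ler_pdivlMr// -subr_le0.
apply: (@nonpos_of_derive_ge0 (fun t => 1 - Phi t - gauss t / t) (fun t => gauss t / t ^+ 2)
  (fun t => 1 - Phi t)) => [t xt|t xt|t xt|].
- have t0 : t != 0 by rewrite gt_eqF// (lt_le_trans x0).
  have := is_derive_Phi t => ?; have := is_derive_gauss t => ?.
  have ? := is_deriveV (f := id) t0 (is_derive_id t 1).
  apply: is_derive_eq; rewrite /GRing.scale/= ?fctE; field.
  exact: t0.
- by rewrite divr_ge0 ?sqr_ge0// ltW// gauss_gt0.
- by rewrite gerBl divr_ge0// ltW ?gauss_gt0// (lt_le_trans x0).
- by rewrite -(subrr 1); apply: cvgB; [exact: cvg_cst|exact: Phi_cvgy].
Qed.

(** After division by [1 + x ^+ 2] the difference of the two sides has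
    derivative [2 * gauss t / (1 + t ^+ 2) ^+ 2] and vanishes at infinity. This
    is the inequality that makes [x * mills x] nondecreasing. *)
Lemma Mills_lower x : x * gauss x <= (1 + x ^+ 2) * (1 - Phi x).
Proof.
have q0 (t : R) : 0 < 1 + t ^+ 2 by rewrite ltr_wpDr ?sqr_ge0.
rewrite [leRHS]mulrC -ler_pdivrMr// -subr_le0.
apply: (@nonpos_of_derive_ge0 (fun t => t * gauss t / (1 + t ^+ 2) - (1 - Phi t))
   (fun t => 2 * gauss t / (1 + t ^+ 2) ^+ 2)
   (fun t => gauss 0 * expR (2^-1) * expR (- t))) => [t xt|t xt|t xt|].
- have t0 : 1 + t ^+ 2 != 0 by rewrite gt_eqF.
  have := is_derive_Phi t => ?; have := is_derive_gauss t => ?.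
  have ? := is_deriveV (f := fun t : R => 1 + t ^+ 2) t0 _.
  apply: is_derive_eq; rewrite /GRing.scale/= ?fctE; field.
  exact: t0.
- by rewrite divr_ge0 ?sqr_ge0// mulr_ge0// ltW// gauss_gt0.
- apply: le_trans (gauss_le_expN t).
  rewrite lerBlDr (@le_trans _ _ (gauss t))//; last first.
    by rewrite lerDl subr_ge0 Phi_le1.
  rewrite ler_pdivrMr// [leRHS]mulrC ler_pM2r ?gauss_gt0//.
  by have := sqr_ge0 (t - 1); rewrite expr2; nra.
- rewrite -[X in _ --> X](mulr0 (gauss 0 * expR 2^-1)).
  by apply: cvgM; [exact: cvg_cst|exact: cvgr_expR].
Qed.

Lemma gaussN x : gauss (- x) = gauss x.
Proof. by rewrite /gauss sqrrN. Qed.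

Lemma Phi_sym x : Phi (- x) = 1 - Phi x.
Proof.
have dN t : is_derive t 1 (fun s : R => Phi (- s)) (- gauss t).
  have := is_derive_Phi (- t) => ?.
  by apply: is_derive_eq; rewrite gaussN mulrN1.
have lim : Phi t + Phi (- t) - 1 @[t --> +oo] --> (0 : R).
  rewrite -[X in _ --> X](subrr 1); apply: cvgB; last exact: cvg_cst.
  rewrite -[X in _ --> X]addr0; apply: cvgD; first exact: Phi_cvgy.
  by have /cvgNy_compNP := @Phi_cvgNy R; exact.
apply/eqP; rewrite eq_le; apply/andP; split; rewrite -subr_le0.
- rewrite opprB addrA addrAC [leLHS](_ : _ = Phi x + Phi (- x) - 1); last by ring.
  apply: (@nonpos_of_derive_ge0 (fun t => Phi t + Phi (- t) - 1) (fun=> 0)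
     (fun t => Phi t + Phi (- t) - 1)) => [t _|t _|t _|]; [|exact: lexx|exact: lexx|exact: lim].
  have := is_derive_Phi t => ?; have := dN t => ?.
  by apply: is_derive_eq; rewrite subrr subr0.
- rewrite [leLHS](_ : _ = - (Phi x + Phi (- x) - 1)); last by ring.
  apply: (@nonpos_of_derive_ge0 (fun t => - (Phi t + Phi (- t) - 1)) (fun=> 0)
     (fun t => - (Phi t + Phi (- t) - 1))) => [t _|t _|t _|]; [|exact: lexx|exact: lexx|].
    have := is_derive_Phi t => ?; have := dN t => ?.
    by apply: is_derive_eq; rewrite subrr subr0 oppr0.
  by rewrite -[X in _ --> X]oppr0; exact: cvgN.
Qed.

(** Mills' ratio of the standard normal law. It solves [y' = x y - 1], which is
    why the bounded solution of Stein's equation is made of two copies of it. *)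
Definition mills x := (1 - Phi x) / gauss x.

Lemma is_derive_mills x : is_derive x 1 mills (x * mills x - 1).
Proof.
have g0 : gauss x != 0 by rewrite gt_eqF// gauss_gt0.
have := is_derive_Phi x => ?; have := is_derive_gauss x => ?.
have ? := is_deriveV (f := @gauss R) g0 _.
rewrite /mills; apply: is_derive_eq; rewrite /GRing.scale/= ?fctE; field.
exact: g0.
Qed.

Lemma mul_mills_le1 x : x * mills x <= 1.
Proof. by rewrite mulrA ler_pdivrMr ?gauss_gt0// mul1r Mills_upper. Qed.

Lemma mul_mills_nondecreasing x y : x <= y -> x * mills x <= y * mills y.
Proof.
move=> xy; rewrite -subr_ge0.
have [|c _ ->] := @is_derive_mean_value (fun t => t * mills t)
    (fun t => (1 + t ^+ 2) * mills t - t) x y xy.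
  move=> t _; have := is_derive_mills t => ?.
  by apply: is_derive_eq; rewrite /GRing.scale/=; ring.
rewrite mulr_ge0 ?subr_ge0// /mills mulrA ler_pdivlMr ?gauss_gt0//.
exact: Mills_lower.
Qed.

(** The bounded solution [f] of Stein's equation
    [f' w = w * f w + (w <= x)%:R - Phi x]. By symmetry of the normal law the
    left branch is the reflected Mills ratio; both branches agree at [w = x]. *)
Definition stein x w :=
  if w <= x then (1 - Phi x) * mills (- w) else Phi x * mills w.

Lemma stein_r x w : x <= w -> stein x w = Phi x * mills w.
Proof.
rewrite /stein; case: (leP w x) => // wx xw.
have -> : w = x by apply/eqP; rewrite eq_le wx.
rewrite /mills gaussN Phi_sym; ring.
Qed.

(** On either side of [x], [w * stein x w] is a nonnegative multiple of
    [w * mills w], reflected on the left. Together with [stein_le] and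
    [stein_ge] this says that its total variation is at most [1]. *)
Lemma stein_nondecreasing x v w : v <= w -> v * stein x v <= w * stein x w.
Proof.
have Pl u s : u <= s -> s <= x -> u * stein x u <= s * stein x s.
  move=> us sx; rewrite /stein sx (le_trans us sx).
  rewrite !(mulrCA _ (1 - Phi x)) ler_wpM2l ?subr_ge0 ?Phi_le1//.
  by rewrite -lerN2 -[X in _ <= X]mulNr -[X in X <= _]mulNr mul_mills_nondecreasing// lerN2.
have Pr u s : u <= s -> x <= u -> u * stein x u <= s * stein x s.
  move=> us xu; rewrite !stein_r// ?(le_trans xu)//.
  by rewrite !(mulrCA _ (Phi x)) ler_wpM2l ?Phi_ge0// mul_mills_nondecreasing.
move=> vw; have [wx|/ltW xw] := leP w x; first exact: Pl.
have [xv|/ltW vx] := leP x v; first exact: Pr.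
exact: le_trans (Pl _ _ vx (lexx _)) (Pr _ _ xw (lexx _)).
Qed.

(** [Phi x] is the limit at [+oo] of the left side, which is nondecreasing in
    [w]. *)
Lemma stein_le x w : w * stein x w <= Phi x.
Proof.
have h u : x <= u -> u * stein x u <= Phi x.
  by move=> xu; rewrite stein_r// mulrCA ler_piMr ?Phi_ge0 ?mul_mills_le1.
apply: le_trans (h (Num.max w x) _); last by rewrite le_max lexx orbT.
by apply: stein_nondecreasing; rewrite le_max lexx.
Qed.

Lemma stein_ge x w : Phi x - 1 <= w * stein x w.
Proof.
have h u : u <= x -> Phi x - 1 <= u * stein x u.
  move=> ux; rewrite /stein ux mulrCA -lerN2 opprB -mulrN -[- (u * _)]mulNr.
  by rewrite ler_piMr ?subr_ge0 ?Phi_le1 ?mul_mills_le1.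
apply: le_trans (h (Num.min w x) _) _; first by rewrite ge_min lexx orbT.
by apply: stein_nondecreasing; rewrite ge_min lexx.
Qed.

(** Mean value form of Stein's equation on an interval that does not have [x] in
    its interior: there the derivative of the solution is a nondecreasing
    function, hence is bounded by its values at the endpoints. *)
Lemma stein_increment (b : bool) x v w : v <= w -> (if b then w <= x else x <= v) ->
  (w - v) * (v * stein x v + (b%:R - Phi x)) <= stein x w - stein x v
     <= (w - v) * (w * stein x w + (b%:R - Phi x)).
Proof.
move=> vw; case: b => hx /=; rewrite ?mulr1n ?mulr0n.
- have [|c /andP[vc cw] E] := @is_derive_mean_value (fun t => (1 - Phi x) * mills (- t))
    (fun t => t * stein x t + (1 - Phi x)) v w vw.
    move=> t /andP[vt tw]; have := is_derive_mills (- t) => ?.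
    apply: is_derive_eq; rewrite /stein (le_trans tw hx) /GRing.scale/=; ring.
  have -> : stein x w - stein x v = (w - v) * (c * stein x c + (1 - Phi x)).
    by rewrite [RHS]mulrC -E /stein hx (le_trans vw hx).
  by rewrite !ler_wpM2l ?subr_ge0// lerD2r stein_nondecreasing.
- have [|c /andP[vc cw] E] := @is_derive_mean_value (fun t => Phi x * mills t)
    (fun t => t * stein x t - Phi x) v w vw.
    move=> t /andP[vt tw]; have := is_derive_mills t => ?.
    by apply: is_derive_eq; rewrite stein_r ?(le_trans hx vt)// /GRing.scale/=; ring.
  have -> : stein x w - stein x v = (w - v) * (c * stein x c + (0 - Phi x)).
    by rewrite sub0r [RHS]mulrC -E !stein_r// (le_trans hx vw).
  by rewrite !ler_wpM2l ?subr_ge0// lerD2r stein_nondecreasing.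
Qed.

End Mills.

(** * Stein's method for sums of independent Bernoulli variables *)

Section PoissonBinomial.
Variable R : realType.

Definition bernoulli_pgf (c : R) : {poly R} := (1 - c)%:P + c *: 'X.

Lemma coef_bernoulli_pgfM c (e : {poly R}) k :
  (bernoulli_pgf c * e)`_k = (1 - c) * e`_k + c * (if k is k'.+1 then e`_k' else 0).
Proof.
rewrite mulrDl coefD coefCM -scalerAl coefZ coefXM.
by case: k.
Qed.

Lemma size_bernoulli_pgfM c (e : {poly R}) m :
  (size e <= m)%N -> (size (bernoulli_pgf c * e)%R <= m.+1)%N.
Proof.
move=> em; apply/leq_sizeP => j mj; rewrite coef_bernoulli_pgfM.
case: j mj => // j mj; rewrite !nth_default ?mulr0 ?addr0//.
  exact: leq_trans em _.
by rewrite (leq_trans em)// ltnW.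
Qed.

(** The expectation of [u (S + b)], for [S] with generating function [e] and an
    independent Bernoulli variable [b] of parameter [c]. *)
Lemma sum_bernoulli_pgfM c (e : {poly R}) m (u : nat -> R) : (size e <= m)%N ->
  \sum_(k < m.+1) (bernoulli_pgf c * e)`_k * u k
  = \sum_(k < m) e`_k * ((1 - c) * u k + c * u k.+1).
Proof.
move=> em.
under eq_bigr do rewrite coef_bernoulli_pgfM mulrDl.
rewrite big_split/= big_ord_recr/= [e`_m]nth_default// mulr0 mul0r addr0.
rewrite [X in _ + X]big_ord_recl/= mulr0 mul0r add0r -big_split/=.
by apply: eq_bigr => k _; ring.
Qed.

Section products.
Variables (I : eqType) (p : I -> R).
Hypothesis p01 : forall i, 0 <= p i <= 1.
Implicit Types u : nat -> R.

Lemma coef_prod_bernoulli_ge0 r (P : pred I) k :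
  0 <= (\prod_(i <- r | P i) bernoulli_pgf (p i))`_k.
Proof.
elim: r k => [|i r IH] k; first by rewrite big_nil coef1 ler0n.
rewrite big_cons; case: ifP => // _; rewrite coef_bernoulli_pgfM.
have /andP[p0 p1] := p01 i.
by rewrite addr_ge0// mulr_ge0 ?subr_ge0//; case: k.
Qed.

Lemma size_prod_bernoulli r (P : pred I) :
  (size (\prod_(i <- r | P i) bernoulli_pgf (p i))%R <= (count P r).+1)%N.
Proof.
elim: r => [|i r IH]; first by rewrite big_nil size_poly1.
by rewrite big_cons /=; case: ifP => // _; rewrite size_bernoulli_pgfM.
Qed.

Lemma horner1_prod_bernoulli r (P : pred I) :
  (\prod_(i <- r | P i) bernoulli_pgf (p i)).[1] = 1.
Proof.
rewrite horner_prod big1// => i _.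
by rewrite hornerD hornerC hornerZ hornerX mulr1 subrK.
Qed.

Lemma deriv_prod_bernoulli (r : seq I) : uniq r ->
  (\prod_(i <- r) bernoulli_pgf (p i))^`()
  = \sum_(i <- r) p i *: \prod_(j <- r | j != i) bernoulli_pgf (p j).
Proof.
elim: r => [|x r IH] /=; first by rewrite !big_nil derivC.
move=> /andP[xr ur]; rewrite !big_cons derivM IH// eqxx/=; congr (_ + _).
  rewrite derivD derivC derivZ derivX add0r alg_polyC mul_polyC; congr (_ *: _).
  rewrite [RHS]big_seq_cond [LHS]big_seq; apply: eq_bigl => j.
  by case: eqVneq => [->|]; rewrite ?(negbTE xr)// andbT.
rewrite big_distrr/= [LHS]big_seq [RHS]big_seq; apply: eq_bigr => i ir.
by rewrite big_cons (negbTE (_ : x != i)) ?scalerAr//; case: eqVneq ir xr => // -> ->.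
Qed.
End products.

Section Stein.
Variables (n : nat) (p : 'I_n -> R).
Hypothesis p01 : forall i, 0 <= p i <= 1.
Implicit Types u : nat -> R.

(** The generating function of a sum of independent Bernoulli variables of
    parameters [p i] (a Poisson-binomial law), so that its coefficients are the
    point probabilities. *)
Definition pb_law : {poly R} := \prod_(i < n) bernoulli_pgf (p i).
Definition pb_law_but i : {poly R} := \prod_(j < n | j != i) bernoulli_pgf (p j).
Definition pb_mean : R := \sum_i p i.
Definition pb_var : R := \sum_i p i * (1 - p i).

Lemma pb_law_split i : pb_law = bernoulli_pgf (p i) * pb_law_but i.
Proof. by rewrite /pb_law (bigD1 i). Qed.

Lemma size_index_ord m : size (index_enum 'I_m) = m.
Proof. by rewrite -sum1_size big_const_ord iter_addn_0 mul1n. Qed.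

Lemma size_law : (size pb_law <= n.+1)%N.
Proof.
by have := size_prod_bernoulli p (index_enum 'I_n) predT; rewrite count_predT size_index_ord.
Qed.

Lemma size_law_but i : (size (pb_law_but i) <= n)%N.
Proof.
apply: leq_trans (size_prod_bernoulli _ _ _) _.
have := count_predC (pred1 i) (index_enum 'I_n).
by rewrite count_uniq_mem ?index_enum_uniq// mem_index_enum add1n => ->; rewrite size_index_ord.
Qed.

Lemma sum_law_but i : \sum_(k < n) (pb_law_but i)`_k = 1.
Proof.
rewrite -(horner1_prod_bernoulli p (index_enum 'I_n) (fun j => j != i)).
rewrite -/(pb_law_but i) (horner_coef_wide _ (size_law_but i)).
by apply: eq_bigr => k _; rewrite expr1n mulr1.
Qed.

Lemma sum_law u i : \sum_(k < n.+1) pb_law`_k * u k =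
   \sum_(k < n) (pb_law_but i)`_k * ((1 - p i) * u k + p i * u k.+1).
Proof. by rewrite (pb_law_split i) sum_bernoulli_pgfM// size_law_but. Qed.

(** The coefficients of ['X * pb_law^`()] are [k%:R * pb_law`_k], and
    differentiating the product removes one factor at a time. *)
Lemma sum_law_deriv u : \sum_(k < n.+1) pb_law`_k * (k%:R * u k)
  = \sum_i p i * \sum_(k < n) (pb_law_but i)`_k * u k.+1.
Proof.
rewrite big_ord_recl/= mul0r mulr0 add0r.
under eq_bigr => k _ do
  rewrite /bump/= add1n mulrA mulr_natr -coef_deriv deriv_prod_bernoulli
    ?index_enum_uniq// coef_sum mulr_suml.
rewrite exchange_big/=; apply: eq_bigr => i _.
by rewrite mulr_sumr; apply: eq_bigr => k _; rewrite coefZ mulrA.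
Qed.

(** The zero-bias identity: [E ((S - E S) u(S))] is the sum over [i] of
    [var b_i * E (u(S_i + 1) - u(S_i))], where [S_i] is [S] without the term
    [b_i]. The mean and the variance are the cases [u = 1] and
    [u k = k%:R - pb_mean]. *)
Lemma Stein_identity u : \sum_(k < n.+1) pb_law`_k * ((k%:R - pb_mean) * u k)
  = \sum_i p i * (1 - p i) * \sum_(k < n) (pb_law_but i)`_k * (u k.+1 - u k).
Proof.
under eq_bigr do rewrite mulrBl mulrBr.
rewrite sumrB sum_law_deriv.
have -> : \sum_(k < n.+1) pb_law`_k * (pb_mean * u k) =
   \sum_i p i * \sum_(k < n.+1) pb_law`_k * u k.
  rewrite -mulr_suml mulr_sumr; apply: eq_bigr => k _; exact: mulrCA.
rewrite -sumrB; apply: eq_bigr => i _; rewrite (sum_law u i) -mulrBr -sumrB -mulrA; congr (_ * _).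
rewrite mulr_sumr; apply: eq_bigr => k _; ring.
Qed.

Lemma law_total : \sum_(k < n.+1) pb_law`_k = 1.
Proof.
rewrite -(horner1_prod_bernoulli p (index_enum 'I_n) predT).
rewrite -/pb_law (horner_coef_wide _ size_law).
by apply: eq_bigr => k _; rewrite expr1n mulr1.
Qed.

Lemma law_mean : \sum_(k < n.+1) pb_law`_k * k%:R = pb_mean.
Proof.
have := Stein_identity (fun=> 1).
rewrite [RHS]big1 => [|i _]; last by rewrite big1 ?mulr0// => k _; rewrite subrr mulr0.
under eq_bigr do rewrite mulr1 mulrBr.
by rewrite sumrB -mulr_suml law_total mul1r => /subr0_eq.
Qed.

Lemma law_var : \sum_(k < n.+1) pb_law`_k * (k%:R - pb_mean) ^+ 2 = pb_var.
Proof.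
transitivity (\sum_(k < n.+1) pb_law`_k * ((k%:R - pb_mean) * (k%:R - pb_mean))) => //.
rewrite (Stein_identity (fun k => k%:R - pb_mean)).
apply: eq_bigr => i _; rewrite -[RHS]mulr1; congr (_ * _).
transitivity (\sum_(k < n) (pb_law_but i)`_k); last exact: sum_law_but.
by apply: eq_bigr => k _; rewrite -natr1; ring.
Qed.

Variables (B : R).
Hypothesis B0 : 0 <= B.
Hypothesis law_but_ub : forall i k, (pb_law_but i)`_k <= B.
Hypothesis var_gt0 : 0 < pb_var.

Let s := Num.sqrt pb_var.
Let z k : R := (k%:R - pb_mean) / s.

Let law_but_ge0 i k : 0 <= (pb_law_but i)`_k.
Proof. exact: coef_prod_bernoulli_ge0. Qed.

Lemma sum_law_but_point i (P : pred nat) :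
  (forall j k, P j -> P k -> j = k) ->
  \sum_(k < n) (pb_law_but i)`_k * (P k)%:R <= B.
Proof.
move=> Pu; have [/existsP[k Pk]|/existsPn nP] := boolP [exists k : 'I_n, P k].
  rewrite (bigD1 k)//= Pk mulr1 big1 ?addr0 => [//|j jk].
  case Pj: (P j); last by rewrite mulr0.
  by move: jk; rewrite -val_eqE/= (Pu _ _ Pj Pk) eqxx.
by rewrite big1// => k _; rewrite (negbTE (nP k)) mulr0.
Qed.

(** The increments are nonnegative, so that each point probability may be
    replaced by [B]; the sum of the increments telescopes. *)
Lemma sum_law_but_increment i (g : nat -> R) :
  (forall k, g k <= g k.+1) -> g n - g 0 <= 1 ->
  \sum_(k < n) (pb_law_but i)`_k * (g k.+1 - g k) <= B.
Proof.
move=> gle g1; apply: (@le_trans _ _ (\sum_(k < n) B * (g k.+1 - g k))).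
  by apply: ler_sum => k _; rewrite ler_wpM2r// subr_ge0.
rewrite -mulr_sumr -(big_mkord predT (fun k => g k.+1 - g k)) telescope_sumr//.
by rewrite ler_piMr.
Qed.

Section point.
Variable K : nat.
Let a := Phi (z K).
Let f k := stein (z K) (z k).
Let g k := z k * f k.

Let s_gt0 : 0 < s. Proof. by rewrite sqrtr_gt0. Qed.

Let zS k : z k.+1 - z k = s^-1.
Proof. by rewrite /z -natr1; field; rewrite gt_eqF. Qed.

Let z_le j k : (j <= k)%N -> z j <= z k.
Proof. by move=> jk; rewrite ler_pM2r ?invr_gt0// lerD2r ler_nat. Qed.

Let g_le k : g k <= g k.+1.
Proof. by apply: stein_nondecreasing; exact: z_le. Qed.

Let g_osc : g n - g 0 <= 1.
Proof.
have := stein_le (z K) (z n); have := stein_ge (z K) (z 0).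
rewrite /g /f; lra.
Qed.

Let df k : g k + ((k < K)%:R - a) <= s * (f k.+1 - f k) <= g k.+1 + ((k < K)%:R - a).
Proof.
have := @stein_increment R (k < K)%N (z K) (z k) (z k.+1).
rewrite zS => /(_ (z_le (leqnSn k))) H.
have {H}/andP[H1 H2] := H (ltac:(by case: ltnP => ?; exact: z_le)).
move: H1 H2; rewrite ![s^-1 * _]mulrC ler_pdivrMr// ler_pdivlMr// ![_ * s]mulrC.
by move=> -> ->.
Qed.

Let stein_zero : \sum_i p i * (1 - p i) * \sum_(k < n) (pb_law_but i)`_k *
   ((1 - p i) * g k + p i * g k.+1 - s * (f k.+1 - f k)) = 0.
Proof.
transitivity (pb_var * \sum_(k < n.+1) pb_law`_k * g k
    - s * \sum_(k < n.+1) pb_law`_k * ((k%:R - pb_mean) * f k)); last first.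
  (* both sides of the difference are [s ^+ 2 * E (g S)] *)
  rewrite -[in LHS](sqr_sqrtr (ltW var_gt0)) -/s expr2 -mulrA -mulrBr mulr_sumr -sumrB big1 ?mulr0//.
  by move=> k _; rewrite /g /z; field; rewrite gt_eqF.
rewrite (Stein_identity f) /pb_var mulr_suml mulr_sumr -sumrB.
apply: eq_bigr => i _; rewrite (sum_law g i) [s * _]mulrCA -mulrBr; congr (_ * _).
by rewrite mulr_sumr -sumrB; apply: eq_bigr => k _; ring.
Qed.

Let sum_weights c : \sum_i p i * (1 - p i) * c = pb_var * c.
Proof. by rewrite /pb_var mulr_suml. Qed.

Let w0 i : 0 <= p i * (1 - p i).
Proof. by have /andP[? ?] := p01 i; rewrite mulr_ge0// subr_ge0. Qed.

(** By [stein_zero] a variance-weighted average over [i] vanishes, and the lower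
    half of [df] bounds its [i]-th term from above by [Phi (z K) - P(S_i < K)]
    plus [p i] times a mean increment of [g], that is, plus at most [p i * B].
    Passing from [P(S_i < K)] to [P(S <= K)] costs [(1 - p i) * P(S_i = K)], and
    the two errors add up to at most [B] for every [i]. *)
Lemma cdf_sub_Phi_le : \sum_(k < n.+1) pb_law`_k * (k <= K)%:R - Phi (z K) <= B.
Proof.
rewrite -/a; set F := (X in X - _).
suff : 0 <= pb_var * (B + a - F) by rewrite pmulr_rge0//; lra.
rewrite -stein_zero -sum_weights; apply: ler_sum => i _; rewrite ler_wpM2l//.
have /andP[p0 p1] := p01 i.
have h1 := sum_law_but_increment i g_le g_osc.
have h2 : \sum_(k < n) (pb_law_but i)`_k * (k == K :> nat)%:R <= B.
  by apply: (@sum_law_but_point i (fun k => k == K)) => j k /eqP -> /eqP ->.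
(* [p i * B] pays for the increments of [g], [(1 - p i) * B] for the atom at [K] *)
have -> : B + a - F = p i * B + (1 - p i) * B + a - F by ring.
have -> : F = \sum_(k < n) (pb_law_but i)`_k * ((k < K)%:R + (1 - p i) * (k == K :> nat)%:R).
  rewrite /F (sum_law (fun k => (k <= K)%:R) i); apply: eq_bigr => k _.
  by congr (_ * _); case: ltngtP => _ /=; ring.
have -> : a = \sum_(k < n) (pb_law_but i)`_k * a by rewrite -mulr_suml sum_law_but mul1r.
apply: (@le_trans _ _ (\sum_(k < n) (pb_law_but i)`_k * (p i * (g k.+1 - g k) - (k < K)%:R + a))).
  apply: ler_sum => k _; rewrite ler_wpM2l//.
  have /andP[+ _] := df k; lra.
have -> : \sum_(k < n) (pb_law_but i)`_k * (p i * (g k.+1 - g k) - (k < K)%:R + a)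
  = p i * \sum_(k < n) (pb_law_but i)`_k * (g k.+1 - g k) +
    (1 - p i) * \sum_(k < n) (pb_law_but i)`_k * (k == K :> nat)%:R +
    \sum_(k < n) (pb_law_but i)`_k * a -
    \sum_(k < n) (pb_law_but i)`_k * ((k < K)%:R + (1 - p i) * (k == K :> nat)%:R).
  by rewrite !mulr_sumr -!big_split -sumrB/=; apply: eq_bigr => k _; ring.
rewrite lerD2r lerD2r; apply: lerD; rewrite ler_wpM2l// subr_ge0//.
Qed.

(** The mirror image of [cdf_sub_Phi_le], with the roles of [p i] and
    [1 - p i] exchanged. *)
Lemma Phi_sub_cdf_le : Phi (z K) - \sum_(k < n.+1) pb_law`_k * (k < K)%:R <= B.
Proof.
rewrite -/a; set F := (X in _ - X).
suff : 0 <= pb_var * (B - a + F) by rewrite pmulr_rge0//; lra.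
rewrite -oppr0 -stein_zero -sum_weights -sumrN; apply: ler_sum => i _.
rewrite -mulrN ler_wpM2l//.
have /andP[p0 p1] := p01 i.
have h1 := sum_law_but_increment i g_le g_osc.
have h2 : \sum_(k < n) (pb_law_but i)`_k * (k.+1 == K :> nat)%:R <= B.
  by apply: (@sum_law_but_point i (fun k => k.+1 == K)) => j k /eqP <- /eqP [].
(* [(1 - p i) * B] pays for the increments of [g], [p i * B] for the atom at
   [K.-1] of the sum without its [i]-th term *)
have -> : B - a + F = (1 - p i) * B + p i * B - a + F by ring.
have -> : F = \sum_(k < n) (pb_law_but i)`_k * ((k < K)%:R - p i * (k.+1 == K :> nat)%:R).
  rewrite /F (sum_law (fun k => (k < K)%:R) i); apply: eq_bigr => k _.
  by congr (_ * _); case: (ltngtP k.+1 K) => _ /=; ring.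
have -> : a = \sum_(k < n) (pb_law_but i)`_k * a by rewrite -mulr_suml sum_law_but mul1r.
rewrite -sumrN.
apply: (@le_trans _ _ (\sum_(k < n) (pb_law_but i)`_k * ((1 - p i) * (g k.+1 - g k) + (k < K)%:R - a))).
  apply: ler_sum => k _; rewrite -mulrN ler_wpM2l//.
  have /andP[_] := df k; lra.
have -> : \sum_(k < n) (pb_law_but i)`_k * ((1 - p i) * (g k.+1 - g k) + (k < K)%:R - a)
  = (1 - p i) * \sum_(k < n) (pb_law_but i)`_k * (g k.+1 - g k) +
    p i * \sum_(k < n) (pb_law_but i)`_k * (k.+1 == K :> nat)%:R -
    \sum_(k < n) (pb_law_but i)`_k * a +
    \sum_(k < n) (pb_law_but i)`_k * ((k < K)%:R - p i * (k.+1 == K :> nat)%:R).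
  by rewrite !mulr_sumr -big_split/= -sumrB -big_split/=; apply: eq_bigr => k _; ring.
rewrite lerD2r lerD2r; apply: lerD; rewrite ler_wpM2l// subr_ge0//.
Qed.
End point.
End Stein.
End PoissonBinomial.

(** * Concentration of a sum of independent Bernoulli variables *)

Section Concentration.
Variable R : realType.

(** Orthogonality of characters on the [N]-th roots of unity; the sum
    telescopes after multiplication by [2 * sin (pi * d / N)]. *)
Lemma sum_cos_root_of_unity N d : (0 < d < N)%N ->
  \sum_(l < N) cos (d%:R * (2 * pi * l%:R / N%:R)) = 0 :> R.
Proof.
move=> /andP[d0 dN].
have Npos : (0 < N)%N by exact: leq_trans d0 (ltnW dN).
have N0 : (0 : R) < N%:R by rewrite ltr0n.
pose h : R := pi * d%:R / N%:R.
have sh : 0 < sin h.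
  apply: sin_gt0_pi; rewrite divr_gt0 ?mulr_gt0 ?pi_gt0 ?ltr0n//=.
  by rewrite /h ltr_pdivrMr// ltr_pM2l ?pi_gt0// ltr_nat.
apply: (@mulfI _ (2 * sin h)); first by rewrite mulf_neq0 ?pnatr_eq0// gt_eqF.
rewrite mulr0.
transitivity (\sum_(0 <= l < N) (sin ((2 * l.+1%:R - 1) * h) - sin ((2 * l%:R - 1) * h))).
  rewrite big_mkord mulr_sumr; apply: eq_bigr => l _.
  have -> : d%:R * (2 * pi * l%:R / N%:R) = 2 * l%:R * h by rewrite /h; field; rewrite gt_eqF.
  have -> : (2 * l.+1%:R - 1) * h = 2 * l%:R * h + h by rewrite -natr1; ring.
  have -> : (2 * l%:R - 1) * h = 2 * l%:R * h - h by ring.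
  by rewrite sinD sinB; ring.
rewrite telescope_sumr// mulr0 sub0r mulN1r sinN opprK.
have -> : (2 * N%:R - 1) * h = - h + (pi *+ 2) *+ d.
  by rewrite -[in RHS]mulr_natr -[pi *+ 2]mulr_natr /h; field; rewrite gt_eqF.
by rewrite (periodicn (@sinD2pi R)) sinN addNr.
Qed.

Lemma Poisson_kernel_partial (r t : R) M :
  (1 - 2 * r * cos t + r ^+ 2) * (1 + 2 * \sum_(1 <= j < M.+1) r ^+ j * cos (j%:R * t))
  = 1 - r ^+ 2 - 2 * r ^+ M.+1 * cos (M.+1%:R * t) + 2 * r ^+ M.+2 * cos (M%:R * t).
Proof.
elim: M => [|M IH].
  by rewrite big_geq// mul0r cos0 mul1r; ring.
rewrite big_nat_recr//= [2 * (_ + _)]mulrDr addrA [LHS]mulrDr IH.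
have -> : M.+2%:R * t = M.+1%:R * t + t by rewrite -[M.+2%:R]natr1; ring.
have -> : M%:R * t = M.+1%:R * t - t by rewrite -natr1; ring.
rewrite cosB cosD !exprS; ring.
Qed.

(** The Poisson kernel is dominated by a trigonometric polynomial, up to an
    error that tends to [0] as [M] grows. Averages of trigonometric polynomials
    over roots of unity of large order are exact, so that finite sums can replace
    integrals over the circle. *)
Lemma Poisson_kernel_le (r t : R) M : 0 <= r < 1 ->
  (1 - r ^+ 2) / (1 - 2 * r * cos t + r ^+ 2) <=
  1 + 2 * \sum_(1 <= j < M.+1) r ^+ j * cos (j%:R * t) + 4 * r ^+ M.+1 / (1 - r) ^+ 2.
Proof.
move=> /andP[r0 r1].
have q0 : 0 < (1 - r) ^+ 2 by rewrite exprn_gt0// subr_gt0.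
have qD : (1 - r) ^+ 2 <= 1 - 2 * r * cos t + r ^+ 2.
  by have := cos_le1 t; nra.
have D0 := lt_le_trans q0 qD.
rewrite ler_pdivrMr// [leRHS]mulrDl [(1 + 2 * _) * _]mulrC Poisson_kernel_partial.
have x0 : 0 <= r ^+ M.+1 by rewrite exprn_ge0.
have h : 4 * r ^+ M.+1 <= 4 * r ^+ M.+1 / (1 - r) ^+ 2 * (1 - 2 * r * cos t + r ^+ 2).
  rewrite mulrAC ler_pdivlMr// ler_wpM2l// mulr_ge0//.
apply: le_trans (lerD (lexx _) h).
have c1 := cos_le1 (M.+1%:R * t); have c2 := cos_geN1 (M%:R * t).
have h1 : r ^+ M.+1 * cos (M.+1%:R * t) <= r ^+ M.+1 by rewrite ler_piMr.
have h2 : - r ^+ M.+1 <= r ^+ M.+2 * cos (M%:R * t).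
  have : 0 <= r ^+ M.+1 * (1 - r + r * (1 + cos (M%:R * t))).
    by rewrite mulr_ge0// addr_ge0 ?mulr_ge0//; lra.
  rewrite [r ^+ M.+2]exprS; lra.
lra.
Qed.

Variables (I : eqType) (p : I -> R).
Hypothesis p01 : forall i, 0 <= p i <= 1.
Variables (r : seq I) (P : pred I).

Let e := \prod_(i <- r | P i) bernoulli_pgf (p i).
Let m := (count P r).+1.
Let V := \sum_(i <- r | P i) p i * (1 - p i).

(** The squared modulus of the characteristic function is multiplicative, and
    that of a Bernoulli variable is [1 - 2 * c * (1 - c) * (1 - cos t)]. *)
Lemma sqr_modulus_prod_bernoulli t :
  (\sum_(k < m) e`_k * cos (k%:R * t)) ^+ 2 + (\sum_(k < m) e`_k * sin (k%:R * t)) ^+ 2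
  = \prod_(i <- r | P i) (1 - 2 * (p i * (1 - p i)) * (1 - cos t)).
Proof.
rewrite /e /m; elim: r => [|i s IH].
  by rewrite !big_nil /= !big_ord_recl !big_ord0 coef1 /= mul0r cos0 sin0; ring.
rewrite /= !big_cons; case: ifP => //= Pi; rewrite add1n -IH.
rewrite (sum_bernoulli_pgfM _ (fun k => cos (k%:R * t))) ?size_prod_bernoulli//.
rewrite (sum_bernoulli_pgfM _ (fun k => sin (k%:R * t))) ?size_prod_bernoulli//.
set q := \prod_(j <- s | P j) _.
set C := \sum_(k < _) q`_k * cos _; set S := \sum_(k < _) q`_k * sin _.
have -> : \sum_(k < (count P s).+1) q`_k *
    ((1 - p i) * cos (k%:R * t) + p i * cos (k.+1%:R * t))
  = (1 - p i) * C + p i * (cos t * C - sin t * S).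
  rewrite !mulr_sumr -sumrB mulr_sumr -big_split/=; apply: eq_bigr => k _.
  by rewrite -natr1 [(_ + 1) * t]mulrDl mul1r cosD; ring.
have -> : \sum_(k < (count P s).+1) q`_k *
    ((1 - p i) * sin (k%:R * t) + p i * sin (k.+1%:R * t))
  = (1 - p i) * S + p i * (cos t * S + sin t * C).
  rewrite !mulr_sumr -big_split/= mulr_sumr -big_split/=; apply: eq_bigr => k _.
  by rewrite -natr1 [(_ + 1) * t]mulrDl mul1r sinD; ring.
have := cos2Dsin2 t; set c := cos t; set d := sin t => cd.
have {}cd : d ^+ 2 = 1 - c ^+ 2 by rewrite -cd; ring.
transitivity ((C ^+ 2 + S ^+ 2) * ((1 - p i) ^+ 2 + 2 * p i * (1 - p i) * c +
   p i ^+ 2 * (c ^+ 2 + d ^+ 2))); first by ring.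
by rewrite cd; ring.
Qed.

Lemma sum_var_ge0 : 0 <= V.
Proof.
by apply: sumr_ge0 => i _; have /andP[? ?] := p01 i; rewrite mulr_ge0// subr_ge0.
Qed.

(** Both sides are compared with [exp (- 2 V (1 - cos t))]. The rational bound is
    chosen because [(1 + V * (1 - cos t))^-1] is proportional to a Poisson
    kernel, whose mean over the circle is explicit. *)
Lemma prod_bernoulli_modulus_le t :
  \prod_(i <- r | P i) (1 - 2 * (p i * (1 - p i)) * (1 - cos t))
  <= (1 + V * (1 - cos t)) ^- 2.
Proof.
have c0 : 0 <= 1 - cos t by rewrite subr_ge0 cos_le1.
have V0 : 0 <= V * (1 - cos t) by rewrite mulr_ge0 ?sum_var_ge0.
apply: (@le_trans _ _ (expR (- (2 * (V * (1 - cos t)))))).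
  have -> : - (2 * (V * (1 - cos t))) =
      \sum_(i <- r | P i) - (2 * (p i * (1 - p i)) * (1 - cos t)).
    by rewrite /V mulr_suml mulr_sumr -sumrN; apply: eq_bigr => i _; rewrite mulrA.
  rewrite expR_sum; apply: ler_prod => i _; have /andP[p0 p1] := p01 i.
  rewrite expR_ge1Dx andbT.
  have := cos_geN1 t; have := cos_le1 t; have : p i * (1 - p i) <= 4^-1.
    by have := sqr_ge0 (2 * p i - 1); rewrite expr2; lra.
  have : 0 <= p i * (1 - p i) by rewrite mulr_ge0// subr_ge0.
  set q := p i * _; set c := cos t => q0 q1 c1 c2; nra.
rewrite expRN lef_pV2 ?posrE ?expR_gt0 ?exprn_gt0 ?ltr_wpDr//.
rewrite (_ : 2 * _ = V * (1 - cos t) *+ 2) ?mulr_natl// -(mulr_natl _ 2) expRM_natl.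
by rewrite ler_pXn2r ?nnegrE ?expR_ge1Dx ?expR_ge0 ?addr_ge0.
Qed.

(** The left side is the real part of the characteristic function times a
    complex number of modulus [1]. *)
Lemma trig_sum_le t k :
  \sum_(j < m) e`_j * cos ((j%:R - k%:R) * t) <= (1 + V * (1 - cos t))^-1.
Proof.
have D0 : 0 < 1 + V * (1 - cos t).
  by rewrite ltr_wpDr// mulr_ge0 ?sum_var_ge0// subr_ge0 cos_le1.
set C := \sum_(j < m) e`_j * cos (j%:R * t); set S := \sum_(j < m) e`_j * sin (j%:R * t).
have -> : \sum_(j < m) e`_j * cos ((j%:R - k%:R) * t) = cos (k%:R * t) * C + sin (k%:R * t) * S.
  rewrite !mulr_sumr -big_split/=; apply: eq_bigr => j _.
  by rewrite mulrBl cosB; ring.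
apply: le_trans (ler_norm _) _.
rewrite -[leRHS]ger0_norm ?invr_ge0 ?(ltW D0)// -ler_sqr ?nnegrE// !real_normK ?num_real// exprVn.
apply: le_trans (prod_bernoulli_modulus_le t); rewrite -sqr_modulus_prod_bernoulli -/C -/S.
have := cos2Dsin2 (k%:R * t); set c := cos _; set d := sin _ => cd.
rewrite -[leRHS]mul1r -cd -subr_ge0.
by rewrite (_ : _ - _ = (c * S - d * C) ^+ 2) ?sqr_ge0//; ring.
Qed.

(** Fourier inversion bounds a point probability by the mean over the circle of
    [(1 + V * (1 - cos t))^-1], which is [(sqrt (1 + 2 V))^-1]. The mean is taken
    over the [M.+1]-th roots of unity, and [M] then tends to infinity. *)
Lemma coef_prod_bernoulli_le k : e`_k <= (Num.sqrt (1 + 2 * V))^-1.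
Proof.
set b := Num.sqrt (1 + 2 * V).
have V0 := sum_var_ge0.
have b2 : b ^+ 2 = 1 + 2 * V by rewrite sqr_sqrtr// addr_ge0// mulr_ge0.
have b1 : 1 <= b by rewrite -ler_sqr ?nnegrE ?sqrtr_ge0// b2 expr1n lerDl mulr_ge0.
have b0 : 0 < b by exact: lt_le_trans b1.
(* the parameter for which [1 - 2 * q * cos t + q ^+ 2] is proportional to
   [1 + V * (1 - cos t)] *)
pose q := (b - 1) / (b + 1).
have q01 : 0 <= q < 1.
  rewrite divr_ge0 ?subr_ge0// ?addr_ge0 ?(ltW b0)//= ltr_pdivrMr ?addr_gt0//; lra.
have [km|km] := ltnP k m; last first.
  rewrite nth_default ?invr_ge0 ?(ltW b0)//.
  exact: leq_trans (size_prod_bernoulli _ _ _) km.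
have kernelE t : (1 + V * (1 - cos t))^-1 =
    b^-1 * ((1 - q ^+ 2) / (1 - 2 * q * cos t + q ^+ 2)).
  have D0 : 0 < 1 + V * (1 - cos t) by rewrite ltr_wpDr// mulr_ge0// subr_ge0 cos_le1.
  have VE : V = (b ^+ 2 - 1) / 2 by rewrite b2; field.
  have bp : b + 1 != 0 by rewrite gt_eqF ?addr_gt0.
  have E1 : 1 - 2 * q * cos t + q ^+ 2 = 4 / (b + 1) ^+ 2 * (1 + V * (1 - cos t)).
    by rewrite VE /q; field.
  have E2 : 1 - q ^+ 2 = 4 * b / (b + 1) ^+ 2 by rewrite /q; field.
  rewrite E1 E2; field; rewrite ?bp ?(gt_eqF D0) ?(gt_eqF b0)//.
have bound M : (m <= M)%N -> e`_k <= b^-1 * (1 + 4 * q ^+ M.+1 / (1 - q) ^+ 2).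
  move=> mM; pose t (l : nat) : R := 2 * pi * l%:R / M.+1%:R.
  have N0 : (0 : R) < M.+1%:R by rewrite ltr0n.
  rewrite -(ler_pM2l N0).
  (* [M.+1] exceeds every [`|j - k|], so only the term [j = k] survives *)
  have -> : M.+1%:R * e`_k = \sum_(l < M.+1) \sum_(j < m) e`_j * cos ((j%:R - k%:R) * t l).
    rewrite exchange_big/= (bigD1 (Ordinal km))//= [X in _ + X]big1 => [|j jk].
      rewrite addr0; under eq_bigr do rewrite subrr mul0r cos0 mulr1.
      by rewrite sumr_const card_ord mulr_natl.
    rewrite -mulr_sumr; have [jk'|kj] := ltnP j k.
      under eq_bigr do rewrite -opprB -natrB ?(ltnW jk')// mulNr cosN.
      rewrite sum_cos_root_of_unity ?mulr0// subn_gt0 jk'/= ltnS.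
      by rewrite (leq_trans (leq_subr _ _))// (leq_trans _ mM)// ltnW.
    under eq_bigr do rewrite -natrB//.
    rewrite sum_cos_root_of_unity ?mulr0// subn_gt0 ltn_neqAle eq_sym kj andbT jk/=.
    by rewrite ltnS (leq_trans (leq_subr _ _))// (leq_trans _ mM)// ltnW.
  apply: (@le_trans _ _ (\sum_(l < M.+1) b^-1 *
      ((1 + 2 * \sum_(1 <= j < M.+1) q ^+ j * cos (j%:R * t l)) + 4 * q ^+ M.+1 / (1 - q) ^+ 2))).
    apply: ler_sum => l _; apply: le_trans (trig_sum_le _ _) _.
    by rewrite kernelE ler_wpM2l ?invr_ge0 ?(ltW b0)// Poisson_kernel_le.
  rewrite -mulr_sumr mulrCA ler_wpM2l ?invr_ge0 ?(ltW b0)//.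
  have S0 : \sum_(l < M.+1) \sum_(1 <= j < M.+1) q ^+ j * cos (j%:R * t l) = 0.
    rewrite exchange_big/= big1_seq// => j.
    rewrite mem_index_iota => /andP[_ /andP[j1 jM]].
    by rewrite -mulr_sumr sum_cos_root_of_unity ?mulr0// j1.
  rewrite big_split big_split/= -mulr_sumr S0 mulr0 addr0 !sumr_const card_ord.
  by rewrite mulrDr mulr1 [X in _ <= _ + X]mulr_natl.
have lim : b^-1 * (1 + 4 * q ^+ n.+1 / (1 - q) ^+ 2) @[n --> \oo] --> b^-1 * (1 + 4 * 0 / (1 - q) ^+ 2).
  apply: cvgM; first exact: cvg_cst.
  apply: cvgD; first exact: cvg_cst.
  apply: cvgM; last exact: cvg_cst.
  apply: cvgM; first exact: cvg_cst.
  have /andP[q0 q1] := q01.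
  have : `|q| < 1 by rewrite ger0_norm.
  move=> /cvg_expr; rewrite -(cvg_shiftS (fun n => q ^+ n)); exact.
rewrite mulr0 mul0r addr0 mulr1 in lim.
apply: (cvgr_to_ge lim); near=> n; apply: bound.
by near: n; exact: nbhs_infty_ge.
Unshelve. all: by end_near. Qed.
End Concentration.

(** * The roots of the polynomials Q *)

Section Roots.
Variable R : realType.
Local Notation Q := (@Q R).

Lemma Q_sum n : (0 < n)%N -> Q n = 'X * \sum_(i < n) (n - i)%:R *: Q i.
Proof.
move=> n0; rewrite Q_rec// big_add1/= big_nat_rev/= big_mkord; congr (_ * _).
by apply: eq_bigr => i _; rewrite add0n subnSK// subKn// ltnW.
Qed.

Lemma Q_succ n : (0 < n)%N -> Q n.+1 = Q n + 'X * \sum_(i < n.+1) Q i.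
Proof.
move=> n0; rewrite !Q_sum// -mulrDr; congr (_ * _).
rewrite !big_ord_recr/= subSnn scale1r addrA -big_split/=; congr (_ + _).
by apply: eq_bigr => i _; rewrite subSn ?(ltnW (ltn_ord i))// -natr1 scalerDl scale1r.
Qed.

Lemma Q_rec2 n : (0 < n)%N -> Q n.+2 = ('X + 2%:P) * Q n.+1 - Q n.
Proof.
move=> n0; rewrite Q_succ// big_ord_recr/= mulrDr.
have -> : 'X * \sum_(i < n.+1) Q i = Q n.+1 - Q n by rewrite Q_succ// addrC addKr.
rewrite -[2]/(1 + 1) polyCD; ring.
Qed.

Lemma Q1 : Q 1 = 'X.
Proof. by rewrite Q_sum// big_ord_recl big_ord0 scale1r addr0 mulr1. Qed.

Lemma Q2 : Q 2 = ('X + 2%:P) * 'X.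
Proof.
rewrite Q_sum// !big_ord_recl big_ord0 /= subn0 addr0 Q1 Q0 scale1r -mul_polyC.
ring.
Qed.

Lemma Q_monic n : size (Q n) = n.+1 /\ Q n \is monic.
Proof.
case: n => [|n]; first by rewrite Q0 size_poly1 monic1.
suff: (size (Q n.+1) = n.+2 /\ Q n.+1 \is monic) /\
      (size (Q n.+2) = n.+3 /\ Q n.+2 \is monic) by case.
elim: n => [|n [IH1 IH2]].
  rewrite Q1 Q2 size_polyX monicX rpredM ?monicX ?monicXaddC//.
  by rewrite size_Mmonic ?monicX ?size_XaddC ?size_polyX// -size_poly_eq0 size_XaddC.
split=> //; rewrite (Q_rec2 (n := n.+1))//.
have X0 : ('X + 2%:P : {poly R}) != 0 by rewrite -size_poly_eq0 size_XaddC.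
have S : size (('X + 2%:P) * Q n.+2) = n.+4.
  by rewrite size_Mmonic ?IH2.2// size_XaddC IH2.1.
have lt : (size (- Q n.+1) < size (('X + 2%:P) * Q n.+2)%R)%N.
  by rewrite size_polyN S IH1.1.
rewrite size_polyDl// S; split=> //.
by rewrite monicE lead_coefDl// -monicE rpredM ?monicXaddC ?IH2.2.
Qed.

(** The second order recurrence turns into that of [sin (n t)], as for the
    Chebyshev polynomials of the second kind. *)
Lemma Q_horner_cos n t : (0 < n)%N ->
  (Q n).[2 * cos t - 2] * sin t = (2 * cos t - 2) * sin (n%:R * t).
Proof.
case: n => // n _.
suff: ((Q n.+1).[2 * cos t - 2] * sin t = (2 * cos t - 2) * sin (n.+1%:R * t)) /\
      ((Q n.+2).[2 * cos t - 2] * sin t = (2 * cos t - 2) * sin (n.+2%:R * t)) by case.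
elim: n => [|n [IH1 IH2]].
  rewrite Q1 Q2 hornerM hornerD hornerX hornerC mul1r; split=> //.
  have -> : sin (2 * t) = 2 * (cos t * sin t) by rewrite !mulr_natl sin_mulr2n.
  by ring.
split=> //; rewrite (Q_rec2 (n := n.+1))// hornerD hornerN hornerM hornerD hornerX hornerC.
rewrite mulrBl -mulrA IH1 IH2.
have -> : n.+3%:R * t = n.+2%:R * t + t by rewrite -[n.+3%:R]natr1; ring.
have -> : n.+1%:R * t = n.+2%:R * t - t by rewrite -[n.+2%:R]natr1; ring.
by rewrite sinB sinD; ring.
Qed.

Definition Qnegroot n j : R := 2 - 2 * cos (j%:R * pi / n%:R).

Lemma Qnegroot_ge0 n j : 0 <= Qnegroot n j.
Proof. by rewrite /Qnegroot; have := cos_le1 (j%:R * pi / n%:R : R); lra. Qed.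

(** By [Q_horner_cos] the numbers [2 * cos (j * pi / n) - 2] with [0 < j < n] are
    roots, the case [j = 0] is the factor ['X], and these [n] numbers are
    distinct. *)
Lemma Q_factor n : (0 < n)%N -> Q n = \prod_(j < n) ('X + (Qnegroot n j)%:P).
Proof.
move=> n0; have [sQ /monicP lQ] := Q_monic n.
have N0 : (0 : R) < n%:R by rewrite ltr0n.
pose rs := [seq - Qnegroot n j | j <- iota 0 n].
have ang j : (j < n)%N -> (j%:R * pi / n%:R : R) \in `[0, pi].
  move=> jn; rewrite in_itv/= divr_ge0 ?mulr_ge0 ?pi_ge0//= ler_pdivrMr//.
  by rewrite mulrC ler_pM2l ?pi_gt0// ler_nat ltnW.
have := @all_roots_prod_XsubC _ (Q n) rs; rewrite lQ scale1r => ->.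
- by rewrite big_map -[n in iota 0 n]subn0 big_mkord; apply: eq_bigr => j _; rewrite polyCN opprK.
- by rewrite sQ size_map size_iota.
- apply/allP => x /mapP[j]; rewrite mem_iota add0n => /= jn ->.
  case: j jn => [_|j jn].
    rewrite /Qnegroot !mul0r cos0 mulr1 subrr oppr0 Q_sum//.
    by rewrite /root hornerM hornerX mul0r.
  pose t : R := j.+1%:R * pi / n%:R.
  have st : sin t != 0.
    rewrite gt_eqF// sin_gt0_pi// divr_gt0 ?mulr_gt0 ?pi_gt0 ?ltr0n//=.
    by rewrite ltr_pdivrMr// mulrC ltr_pM2l ?pi_gt0// ltr_nat.
  rewrite /root /Qnegroot opprB -/t -(mulIr_eq0 _ (mulIf st)) Q_horner_cos//.
  have -> : n%:R * t = 0 + pi *+ j.+1.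
    by rewrite /t add0r -[RHS]mulr_natl; field; rewrite gt_eqF.
  by rewrite (alternatingn (@sinDpi R)) sin0 !mulr0.
- rewrite uniq_rootsE map_inj_in_uniq ?iota_uniq// => j k; rewrite !mem_iota !add0n => /= jn kn.
  move=> /oppr_inj /addrI /oppr_inj /mulfI -/(_ ltac:(by rewrite pnatr_eq0)).
  move=> /(cos_inj (ang _ jn) (ang _ kn)).
  move=> /mulIf -/(_ ltac:(by rewrite invr_eq0 gt_eqF)) /mulIf -/(_ ltac:(by rewrite gt_eqF ?pi_gt0)).
  by move/eqP; rewrite eqr_nat => /eqP.
Qed.

(** Normalised to take the value [1] at [1], the factor ['X + c] becomes the
    generating function of a Bernoulli variable of parameter [(1 + c)^-1]. *)
Definition Qprob n (j : 'I_n) : R := (1 + Qnegroot n j)^-1.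

Lemma Qprob01 n (j : 'I_n) : 0 <= Qprob j <= 1.
Proof.
have h : 0 <= Qnegroot n j := Qnegroot_ge0 n j.
by rewrite invr_ge0 addr_ge0//= invf_le1 ?ltr_wpDr// lerDl.
Qed.

Lemma Q_law n : (0 < n)%N ->
  Q n = (\prod_(j < n) (1 + Qnegroot n j)) *: pb_law (@Qprob n).
Proof.
move=> n0; rewrite Q_factor// /pb_law -scaler_prod; apply: eq_bigr => j _.
have h : 1 + Qnegroot n j != 0 by rewrite gt_eqF// ltr_wpDr// Qnegroot_ge0.
rewrite /bernoulli_pgf scalerDr scalerA /Qprob divff// scale1r addrC; congr (_ + _).
by rewrite -mul_polyC -polyCM mulrBr mulr1 divff// addrC addKr.
Qed.

Lemma A_pb_law n k : (0 < n)%N ->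
  A R n k / \sum_(0 <= m < n.+1) A R n m = (pb_law (@Qprob n))`_k.
Proof.
move=> n0; set kappa := \prod_(j < n) (1 + Qnegroot n j).
have k0 : kappa != 0.
  by apply/prodf_neq0 => j _; rewrite gt_eqF// ltr_wpDr// Qnegroot_ge0.
have AE m : A R n m = kappa * (pb_law (@Qprob n))`_m by rewrite /A Q_law// coefZ.
under eq_bigr do rewrite AE.
by rewrite -mulr_sumr big_mkord law_total mulr1 AE mulrC mulKf.
Qed.

Lemma Qprob_var_gt0 n : (2 <= n)%N -> 0 < pb_var (@Qprob n).
Proof.
move=> n2; have n0 : (0 < n)%N by exact: ltnW.
have w0 (j : 'I_n) : 0 <= Qprob j * (1 - Qprob j).
  by have /andP[? ?] := Qprob01 j; rewrite mulr_ge0// subr_ge0.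
rewrite /pb_var (bigD1 (Ordinal n2))//= ltr_pwDl ?sumr_ge0//.
have r0 : 0 < Qnegroot n 1.
  rewrite /Qnegroot mul1r; set x := pi / n%:R.
  have x0 : 0 < x by rewrite divr_gt0 ?pi_gt0// ltr0n.
  have xpi : x <= pi.
    by rewrite ler_pdivrMr ?ltr0n// ler_peMr ?pi_ge0// ler1n.
  have : cos x < cos 0 by rewrite ltr_cos// in_itv/= ?lexx ?pi_ge0// (ltW x0).
  by rewrite cos0; lra.
rewrite mulr_gt0 ?invr_gt0 ?subr_gt0 ?invf_lt1 ?ltrDl// ltr_wpDr// ltW//.
Qed.

End Roots.

(** * A Berry-Esseen bound for sums of independent Bernoulli variables *)

Section PBBerryEsseen.
Variables (R : realType) (n : nat) (p : 'I_n -> R).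
Hypothesis p01 : forall i, 0 <= p i <= 1.
Hypothesis var_gt0 : 0 < pb_var p.

(** Removing one term lowers the variance by at most [1 / 4], which the summand
    [1] in [coef_prod_bernoulli_le] compensates. *)
Lemma law_but_le i k : (pb_law_but p i)`_k <= (Num.sqrt (2 * pb_var p))^-1.
Proof.
have := @coef_prod_bernoulli_le R _ p p01 (index_enum 'I_n) (fun j => j != i) k.
rewrite -/(pb_law_but p i); set V := (\sum_(j < n | j != i) _) => /le_trans; apply.
have VE : pb_var p = p i * (1 - p i) + V by rewrite /pb_var (bigD1 i).
have V0 : 0 <= V by exact: sum_var_ge0.
have D0 : 0 < 1 + 2 * V by rewrite ltr_wpDr// mulr_ge0.
rewrite lef_pV2 ?posrE ?sqrtr_gt0 ?mulr_gt0// ler_sqrt ?(ltW D0)//.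
by have := sqr_ge0 (2 * p i - 1); rewrite VE expr2; lra.
Qed.

(** The atoms are increasing, so those in [`]-oo, x]] form an initial segment. *)
Lemma threshold (z : nat -> R) x N : {homo z : j k / (j <= k)%N >-> j <= k} ->
  exists2 K, (K <= N)%N & forall k, (k < N)%N -> (z k <= x) = (k < K)%N.
Proof.
move=> zle; elim: N => [|N [K KN IH]]; first by exists 0%N.
have [zx|xz] := leP (z N) x.
  exists N.+1 => // k kN; rewrite kN; apply: le_trans zx.
  by apply: zle; rewrite -ltnS.
exists K => [|k]; first exact: leqW.
rewrite ltnS leq_eqVlt => /predU1P[->|]; last exact: IH.
by rewrite leNgt xz ltnNge KN.
Qed.

(** Between consecutive atoms the distribution function is constant and [Phi] is
    monotone, so the bounds at the atoms suffice. *)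
Lemma pb_Berry_Esseen (x : R) :
  `| \sum_(k < n.+1) (pb_law p)`_k * ((k%:R - pb_mean p) / Num.sqrt (pb_var p) <= x)%R%:R - Phi x |
    <= (Num.sqrt (2 * pb_var p))^-1.
Proof.
set s := Num.sqrt (pb_var p); set F := (X in `|X - _|).
have s0 : 0 < s by rewrite sqrtr_gt0.
pose z k := (k%:R - pb_mean p) / s.
have B0 : 0 <= (Num.sqrt (2 * pb_var p))^-1 by rewrite invr_ge0 sqrtr_ge0.
have [|K KN KE] := @threshold z x n.+1.
  by move=> j k jk; rewrite ler_pM2r ?invr_gt0// lerD2r ler_nat.
have FE : F = \sum_(k < n.+1) (pb_law p)`_k * (k < K)%:R.
  by apply: eq_bigr => k _; rewrite -[X in X%:R]/(nat_of_bool (z k <= x)) KE.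
rewrite ler_norml lerNl opprB FE; apply/andP; split.
  move: KN; rewrite leq_eqVlt => /predU1P[->|KN].
    rewrite (eq_bigr (fun k : 'I_n.+1 => (pb_law p)`_k)) => [|k _]; last by rewrite ltn_ord mulr1.
    by rewrite law_total; apply: le_trans B0; rewrite subr_le0 Phi_le1.
  apply: le_trans (Phi_sub_cdf_le p01 B0 law_but_le var_gt0 K).
  by rewrite lerD2r Phi_nondecreasing// ltW// ltNge KE// ltnn.
case: K KN KE {FE} => [_ _|K KN KE].
  rewrite big1 => [|k _]; last by rewrite ltn0 mulr0.
  by apply: le_trans B0; rewrite sub0r oppr_le0 Phi_ge0.
apply: le_trans (cdf_sub_Phi_le p01 B0 law_but_le var_gt0 K).
by rewrite lerD2l lerN2 Phi_nondecreasing// KE.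
Qed.
End PBBerryEsseen.

(** * Random variables with values in an initial segment of the integers *)

Section RandomVariable.
Variables (R : realType) (d : measure_display) (T : measurableType d) (P : probability T R).
Variables (X : {RV P >-> R}) (n : nat) (w : nat -> R).
Hypothesis Xval : forall t, exists2 k : nat, (k <= n)%N & X t = k%:R.
Hypothesis Xprob : forall k : nat, (k <= n)%N -> P [set t | X t = k%:R] = (w k)%:E.

Lemma expectation_finite_range (phi : R -> R) :
  ('E_P[phi \o X] = (\sum_(k < n.+1) w k * phi k%:R)%R%:E)%E.
Proof.
pose A (k : nat) := [set t | X t = k%:R].
have mA k : measurable (A k).
  exact: (measurable_funPTI X (measurable_set1 (k%:R : R))).
have phiE t : (phi (X t))%:E = (\sum_(k < n.+1) (phi k%:R)%:E * (\1_(A k) t)%:E)%E.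
  have [k kn Xk] := Xval t; rewrite sumEFin; congr EFin.
  rewrite (bigD1 (Ordinal (kn : k < n.+1)%N))//= big1 => [|j jk].
    by rewrite addr0 indicE mem_set// mulr1 Xk.
  rewrite indicE memNset ?mulr0// /A/= Xk => /eqP; rewrite eqr_nat => /eqP kj.
  by move: jk; rewrite -val_eqE/= kj eqxx.
rewrite unlock; under eq_integral do rewrite phiE.
rewrite integral_sum//; last first.
  by move=> k; apply: integrableZl => //; exact: integrable_indic.
rewrite -sumEFin; apply: eq_bigr => k _.
rewrite integralZl//; last exact: integrable_indic.
rewrite integral_indic// setIT EFinM muleC; congr (_ * _)%E.
by apply: Xprob; rewrite -ltnS.
Qed.

Lemma mean_finite_range : mean X = \sum_(k < n.+1) w k * k%:R.
Proof. by rewrite /mean (expectation_finite_range id). Qed.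

Lemma stddev_finite_range :
  stddev X = Num.sqrt (\sum_(k < n.+1) w k * (k%:R - mean X) ^+ 2).
Proof.
rewrite /stddev /variance unlock.
have := expectation_finite_range (fun y => (y - mean X) ^+ 2).
by rewrite -/(mean X) => ->.
Qed.

Lemma cdf_finite_range (z : R -> R) x : measurable_fun setT z ->
  fine (P [set t | z (X t) <= x]) = \sum_(k < n.+1) w k * (z k%:R <= x)%R%:R.
Proof.
move=> mz; have := expectation_finite_range (fun y => (z y <= x)%R%:R).
set E := [set t | _]; have mE : measurable E.
  have -> : E = (z \o X) @^-1` `]-oo, x].
    by apply/seteqP; split => t /=; rewrite in_itv.
  by rewrite -[X in measurable X]setTI; apply: (measurableT_comp mz).
rewrite [X in ('E_P[X])%E](_ : _ = \1_E).
  by rewrite expectation_indic// => ->.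
apply/funext => t; rewrite indicE /=; congr (_%:R); congr nat_of_bool.
by apply/idP/idP; rewrite inE.
Qed.
End RandomVariable.

(** * The normal approximation of the coefficients of Q *)

Lemma inv_sqrt2_le (R : realType) : (Num.sqrt 2)^-1 <= 319 / 400 :> R.
Proof.
have s2 : Num.sqrt 2 ^+ 2 = 2 :> R by rewrite sqr_sqrtr.
have s0 : 0 < Num.sqrt 2 :> R by rewrite sqrtr_gt0.
move: s0 s2; set s := Num.sqrt 2 => s0 s2.
have -> : s^-1 = s / 2 by rewrite -s2; field; rewrite gt_eqF.
by move: s2; rewrite expr2; nra.
Qed.

(* 319 / 400 = 0.7975 *)
Theorem theorem1p8 (R : realType) :
  (exists C : R, 0 < C /\ normal_approximation C) /\
  normal_approximation (319 / 400 : R).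
Proof.
suff main : normal_approximation (319 / 400 : R).
  by split; [exists (319 / 400); split; [lra|]|].
move=> n n2 d T P X [Xval Xprob] x.
have n0 : (0 < n)%N by exact: ltnW.
pose p := @Qprob R n.
have {}Xprob k : (k <= n)%N -> P [set t | X t = k%:R] = ((pb_law p)`_k)%:E.
  by move=> kn; rewrite Xprob// A_pb_law.
have meanE : mean X = pb_mean p by rewrite (mean_finite_range Xval Xprob) law_mean.
have sdE : stddev X = Num.sqrt (pb_var p).
  by rewrite (stddev_finite_range Xval Xprob) meanE law_var.
rewrite meanE sdE.
rewrite (cdf_finite_range Xval Xprob (z := fun y => (y - pb_mean p) / Num.sqrt (pb_var p))).
  apply: le_trans (pb_Berry_Esseen _ _ x) _; [exact: Qprob01|exact: Qprob_var_gt0|].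
  by rewrite sqrtrM// invfM ler_wpM2r ?invr_ge0 ?sqrtr_ge0 ?inv_sqrt2_le.
by apply: measurable_funM => //; exact: measurable_funB.
Qed.
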